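(* Let $q \equiv 1 \pmod 4$ be a prime power, let $\chi_4\in\widehat{\mathbb{F}_q^*}$ be a character of order $4$, and let $A,B\in\widehat{\mathbb{F}_q^*}$ with $A^4 \neq \varepsilon$, $B^8 \neq \varepsilon$ and $A^2 \neq \varphi B^4$. Then $${}_{8}F_{8}\left( \begin{array}{cccccccc} A, & \varphi A, & \chi_4 A, & \overline{\chi_4} A, & B, & \varphi B, & \chi_4 B, & \overline{\chi_4} B\\ \varepsilon, & \varphi, & \chi_4, & \overline{\chi_4}, & A\overline{B}, & \varphi A\overline{B}, & \chi_4 A\overline{B}, & \overline{\chi_4} A\overline{B} \end{array} \Big| \; 1 \right)_{q}$$ $$= \frac{g(B^4)\,g(\overline{A}^4 B^8)}{g(\overline{A}^4 B^4)\,g(B^8)} + \sum_{R^2=A^4} \frac{g(\overline{A}^4)\,g(\overline{R} B^4)}{g(\overline{R})\,g(\overline{A}^4 B^4)} + \frac{g(\overline{A}^2) \, g(\overline{A}^2\varphi B^4) }{g(\overline{A}^2B^2) \, g( \overline{A}^2\varphi B^2)} \sum_{R^2=A^2} {}_{3}F_2\left( \begin{array}{ccc} R \varphi \overline{A}^2, & B^2, & \varphi B^2 \\ & R, & \varphi \end{array} \Big| \; 1 \right)_{q},$$ where the sums are over $R\in\widehat{\mathbb{F}_q^*}$ with $R^2=A^4$ and $R^2=A^2$, respectively.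
   Context: $\mathbb{F}_q$ is the finite field with $q$ elements and $\widehat{\mathbb{F}_q^*}$ the group of (complex) multiplicative characters of $\mathbb{F}_q^*$; every $\chi\in\widehat{\mathbb{F}_q^*}$, including the trivial character $\varepsilon$, is extended to $\mathbb{F}_q$ by $\chi(0):=0$; $\overline{\chi}$ is the inverse of $\chi$; $\varphi$ is the character of order two. Fix a non-trivial additive character $\theta$ of $\mathbb{F}_q$ and define the Gauss sum $g(\chi):=\sum_{x\in\mathbb{F}_q}\chi(x)\theta(x)$. For $A_i,B_i\in\widehat{\mathbb{F}_q^*}$ and $\lambda\in\mathbb{F}_q$, $${}_{m}F_{m}\left( \begin{array}{ccc} A_1, & \dots, & A_m \\ B_1, & \dots, & B_m \end{array} \Big| \; \lambda \right)_{q} := \frac{-1}{q-1} \sum_{\chi \in \widehat{\mathbb{F}_q^{*}}} \prod_{i=1}^{m} \frac{g(A_i \chi)}{g(A_i)} \frac{g(\overline{B_i \chi})}{g(\overline{B_i})}\, \chi(-1)^{m} \chi(\lambda).$$ The notation ${}_{3}F_{2}\left(\begin{array}{ccc}A_1,&A_2,&A_3\\&B_2,&B_3\end{array}\Big|\;\lambda\right)_q$ means ${}_{3}F_{3}\left(\begin{array}{ccc}A_1,&A_2,&A_3\\ \varepsilon,&B_2,&B_3\end{array}\Big|\;\lambda\right)_q$. *)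

(* Defs.v *)
(* Complex characters of finite groups take algebraic values
   and are modelled, as in mathcomp.character, with values in algC. *)
From HB Require Import structures.
From mathcomp Require Import all_boot all_order all_algebra all_fingroup.
From mathcomp Require Import all_solvable all_field all_character.
Set Implicit Arguments.
Unset Strict Implicit.
Unset Printing Implicit Defensive.
Import GroupScope GRing.Theory.
Local Open Scope ring_scope.

(* The type containing the multiplicative characters of F: the group F^* is
   [set: {unit F}], and its character group consists of the linear characters,
   with the pointwise product and 1 as the trivial character epsilon. *)
Notation mulCF F := 'CF([set: {unit F}]).

(* The group here is (F, +): a finFieldType is a finGroupType for addition. *)
Notation addCF F := 'CF([set: (F : finFieldType)]).

(* All multiplicative characters, without repetition: F^* is abelian, so its
   irreducible characters are exactly its linear ones. *)
Definition mulchars (F : finFieldType) : seq (mulCF F) :=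
  irr [set: {unit F}].

Lemma mem_mulchars (F : finFieldType) (chi : mulCF F) :
  (chi \in mulchars F) = (chi \is a linear_char).
Proof.
apply/idP/idP => [/irrP[i ->]|/lin_char_irr //].
have cFF : abelian [set: {unit F}].
  apply/centsP=> u _ v _; apply: val_inj; exact: mulrC.
exact: (char_abelianP _ cFF).
Qed.

Lemma uniq_mulchars (F : finFieldType) : uniq (mulchars F).
Proof. exact: free_uniq (irr_free _). Qed.

(* Extension by 0 to F, also for the trivial character. *)
Definition mext (F : finFieldType) (chi : mulCF F) (x : F) : algC :=
  if insub x is Some u then chi u else 0.

Definition gauss (F : finFieldType) (theta : addCF F) (chi : mulCF F) : algC :=
  \sum_(x : F) mext chi x * theta x.

Definition hyperF (F : finFieldType) (theta : addCF F) (m : nat)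
    (A B : m.-tuple (mulCF F)) (lambda : F) : algC :=
  - 1 / (#|F|%:R - 1) *
  \sum_(chi <- mulchars F)
    (\prod_(i < m)
       (gauss theta (tnth A i * chi) / gauss theta (tnth A i) *
        (gauss theta (tnth B i * chi)^-1 / gauss theta (tnth B i)^-1))) *
    mext chi (- 1) ^+ m * mext chi lambda.

Definition hyper3F2 (F : finFieldType) (theta : addCF F)
    (A1 A2 A3 B2 B3 : mulCF F) (lambda : F) : algC :=
  hyperF theta [tuple A1; A2; A3] [tuple 1; B2; B3] lambda.

(* Main.v *)
(* Put alpha = A^4, beta = B^4 and let i be a square root of -1 in F.  By the
   Hasse-Davenport product relation the 8F8 is a sum over chi of a function of
   chi^4.  Writing the products of Gauss sums as Jacobi sums and summing over
   chi turns it into g(beta) / (g(alpha) g(beta / alpha)) times the sum over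
   z in {1, -1, i, -i} of
     U(z) = \sum_s alpha(s) beta(z) / (beta(1 + s) beta(s + z)).
   U(1) is a Jacobi sum (Gauss's theorem: the first term).  U(-1) is a sum over
   squares, which splits over the two square roots of alpha (Kummer's theorem:
   the second term).  U(i) and U(-i) reduce by translation to
     \sum_x alpha(x + i) / beta(x^2 - 1),
   which is transformed in lemma quadratic_transformation.  In the same way each
   3F2(1) is, up to Gauss sums, the right-hand sum of that lemma; the two square
   roots R of A^2 give equal values, and so do i and -i. *)
Require Import Defs.
From HB Require Import structures.
From mathcomp Require Import all_boot all_order all_algebra all_fingroup.
From mathcomp Require Import all_solvable all_field all_character.
From mathcomp Require Import ring.
Set Implicit Arguments.
Unset Strict Implicit.
Unset Printing Implicit Defensive.
Import GroupScope GRing.Theory.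
Local Open Scope ring_scope.

(** * Multiplicative characters of a finite field *)

Section MultiplicativeCharacters.

Variable F : finFieldType.
Implicit Types (chi psi : mulCF F) (x y : F).

Lemma mext_val chi (u : {unit F}) : mext chi (val u) = chi u.
Proof. by rewrite /mext valK. Qed.

Lemma mext_unitP x : x != 0 -> exists u : {unit F}, x = val u.
Proof. by rewrite -unitfE => ux; exists (FinRing.unit F ux). Qed.

Lemma mext0 chi : mext chi 0 = 0.
Proof. by rewrite /mext insubF // unitr0. Qed.

Lemma mextM chi psi x : mext (chi * psi) x = mext chi x * mext psi x.
Proof.
have [->|/mext_unitP[u ->]] := eqVneq x 0; first by rewrite !mext0 mulr0.
by rewrite !mext_val cfunE.
Qed.

Lemma mext1 x : mext 1 x = (x != 0)%:R.
Proof.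
have [->|/mext_unitP[u ->]] := eqVneq x 0; first by rewrite mext0.
by rewrite mext_val cfun1E inE.
Qed.

(** The exponent is a successor because at [x = 0] the trivial character extends to 0, whereas
    [0 ^+ 0 = 1]. *)
Lemma mextX chi n x : mext (chi ^+ n.+1) x = mext chi x ^+ n.+1.
Proof. by elim: n => [|n IHn]; rewrite ?expr1 // exprS mextM IHn -exprS. Qed.

Lemma mext_inj chi psi : (forall x, mext chi x = mext psi x) -> chi = psi.
Proof. by move=> e; apply/cfun_inP => u _; rewrite -!mext_val. Qed.

Section Linear.

Variable chi : mulCF F.
Hypothesis chi_lin : chi \is a linear_char.

Lemma mext_1 : mext chi 1 = 1.
Proof. by rewrite (mext_val chi (1%g : {unit F})) lin_char1. Qed.

Lemma mext_mul x y : mext chi (x * y) = mext chi x * mext chi y.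
Proof.
have [->|/mext_unitP[u ->]] := eqVneq x 0; first by rewrite mul0r mext0 mul0r.
have [->|/mext_unitP[v ->]] := eqVneq y 0; first by rewrite mulr0 mext0 mulr0.
by rewrite (mext_val chi (u * v)%g) !mext_val lin_charM.
Qed.

Lemma mext_neq0 x : x != 0 -> mext chi x != 0.
Proof. by case/mext_unitP=> u ->; rewrite mext_val lin_char_neq0. Qed.

Lemma mext_inv x : mext chi x^-1 = (mext chi x)^-1.
Proof.
have [->|nz] := eqVneq x 0; first by rewrite invr0 mext0 invr0.
apply: (mulfI (mext_neq0 nz)).
by rewrite -mext_mul !divff ?mext_1 ?mext_neq0.
Qed.

Lemma mext_exp n x : mext chi (x ^+ n) = mext chi x ^+ n.
Proof.
by elim: n => [|n IHn]; rewrite ?mext_1 // !exprS mext_mul IHn.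
Qed.

Lemma mextV x : mext chi^-1 x = (mext chi x)^-1.
Proof.
have [->|nz] := eqVneq x 0; first by rewrite !mext0 invr0.
apply: (mulfI (mext_neq0 nz)).
by rewrite -mextM divrr ?lin_char_unitr // mext1 nz divff ?mext_neq0.
Qed.

Lemma mext_evenX_N1 n : mext (chi ^+ n.+1.*2) (-1) = 1.
Proof.
rewrite doubleS mextX -mext_exp // -doubleS -mul2n exprM sqrrN.
by rewrite !expr1n mext_1.
Qed.

(** Replacing [x] by [y * x], with [y] chosen so that [chi] is not 1 at [y], multiplies the sum by a
    factor other than 1. *)
Lemma sum_mext : chi != 1 -> \sum_x mext chi x = 0.
Proof.
move=> chi1.
have [y nzy chiy] : exists2 y, y != 0 & mext chi y != 1.
  apply/exists_inP; apply: contraR chi1 => /exists_inPn h.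
  apply/eqP/mext_inj => x; rewrite mext1.
  by have [->|/h/negPn/eqP] := eqVneq x 0; first by rewrite mext0.
apply: (mulfI (_ : mext chi y - 1 != 0)); first by rewrite subr_eq0.
rewrite mulr0 mulrBl mul1r mulr_sumr.
rewrite [X in _ - X](reindex_inj (mulfI nzy)) /=.
by apply/eqP; rewrite subr_eq0; apply/eqP/eq_bigr => x _; rewrite mext_mul.
Qed.

End Linear.

End MultiplicativeCharacters.

(** Second orthogonality relation between the classes of [u] and 1. The unit group is abelian, so
    the centraliser is the whole group, of order q - 1. *)
Lemma sum_mulchars (F : finFieldType) (x : F) :
  \sum_(chi <- mulchars F) mext chi x = (#|F|%:R - 1) * (x == 1)%:R.
Proof.
have [->|/mext_unitP[u ->]] := eqVneq x 0.
  by rewrite eq_sym oner_eq0 mulr0 big1 // => chi _; rewrite mext0.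
rewrite /mulchars big_tuple.
under eq_bigr => i _ do rewrite mext_val.
have := second_orthogonality_relation u (group1 [set: {unit F}]).
have cFF : abelian [set: {unit F}].
  by apply/centsP=> v _ w _; apply: val_inj; exact: mulrC.
have -> : 'C_[set: {unit F}][u]%g = [set: {unit F}].
  apply/setP=> v; rewrite inE in_setT cent1E.
  by apply/eqP; apply: val_inj; exact: mulrC.
rewrite class1G inE card_finField_unit -subn1.
rewrite natrB ?(ltnW (finNzRing_gt1 F)) //.
rewrite -mulr_natr -(inj_eq val_inj) => <-.
apply: eq_bigr => i _.
have /char_abelianP/(_ i) Li := cFF.
by rewrite (lin_char1 Li) rmorph1 mulr1 (tnth_nth 0).
Qed.

Lemma sqrtN1_exists (F : finFieldType) : #|F| = 1 %[mod 4] ->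
  exists2 i : F, i ^+ 2 = -1 & (2 != 0 :> F).
Proof.
move=> q1mod4.
have /cyclicP[z Dz] := field_unit_group_cyclic [set: {unit F}].
have oz : #[z]%g = #|F|.-1 by rewrite orderE -Dz card_finField_unit.
have q_gt1 := finNzRing_gt1 F.
have dvd4 : (4 %| #|F|.-1)%N.
  by rewrite -subn1 -eqn_mod_dvd ?(ltnW q_gt1) //; apply/eqP.
set k := (#|F|.-1 %/ 4)%N; have Dq : #|F|.-1 = (k * 4)%N by rewrite divnK.
have k_gt0 : (0 < k)%N.
  by rewrite divn_gt0 // dvdn_leq // -subn1 subn_gt0.
(* With [z] a generator and k = (q - 1)/4, [i] has exact order 4. *)
pose i : F := val z ^+ k.
have valX (u : {unit F}) n : val (u ^+ n)%g = val u ^+ n :> F.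
  by elim: n => [|n IHn]; rewrite ?expg0 // expgS exprS -IHn.
have i4 : i ^+ 4 = 1 by rewrite -exprM -Dq -valX -oz expg_order.
have i2 : i ^+ 2 != 1.
  rewrite -exprM -valX -[1]/(val (1%g : {unit F})) (inj_eq val_inj).
  by rewrite -order_dvdn oz Dq gtnNdvd ?ltn_pmul2l ?muln_gt0 ?k_gt0.
have i2N : i ^+ 2 = -1.
  apply/eqP; rewrite -addr_eq0; move/eqP: i4; rewrite -subr_eq0.
  rewrite (_ : i ^+ 4 - 1 = (i ^+ 2 - 1) * (i ^+ 2 + 1)); last by ring.
  by rewrite mulf_eq0 subr_eq0 (negPf i2).
(* In characteristic two, -1 = 1 would give [i ^+ 2 = 1]. *)
exists i => //; apply: contra i2 => /eqP two0; rewrite i2N -subr_eq0.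
by rewrite -opprD -[1 + 1]/2 two0 oppr0.
Qed.

(** * The quadratic character and square roots, of field elements and of characters *)

Section QuadraticCharacter.

Variables (F : finFieldType) (phi : mulCF F).
Hypotheses (phi_lin : phi \is a linear_char) (phi2 : phi ^+ 2 = 1).
Hypotheses (phi_neq1 : phi != 1) (two_neq0 : 2 != 0 :> F).

Lemma phi_sqr x : x != 0 -> mext phi x ^+ 2 = 1.
Proof. by rewrite -mextX phi2 mext1 => ->. Qed.

Lemma invr_phi : phi^-1 = phi.
Proof.
have Uphi := lin_char_unitr phi_lin.
by apply: (mulrI Uphi); rewrite divrr // -expr2.
Qed.

(** Stated for any [chi] of order two, so that two such characters can be compared on a generator
    and found equal. *)
Lemma order2_generator (z : {unit F}) (chi : mulCF F) :
    [set: {unit F}] = <[z]>%g ->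
  chi \is a linear_char -> chi ^+ 2 = 1 -> chi != 1 -> chi z = -1.
Proof.
move=> Dz Lchi chi2 chi1.
have chiz : chi z ^+ 2 = 1 by rewrite -expS_cfunE chi2 cfun1E inE.
have : (chi z - 1) * (chi z + 1) = 0.
  by rewrite (_ : _ * _ = chi z ^+ 2 - 1); [rewrite chiz subrr | ring].
move/eqP; rewrite mulf_eq0 subr_eq0 addr_eq0 => /orP[/eqP chiz1|/eqP//].
case/eqP: chi1; apply/cfun_inP => u _.
have /cycleP[k ->] : u \in <[z]>%g by rewrite -Dz inE.
rewrite cfun1E inE.
by rewrite lin_charX // chiz1 expr1n.
Qed.

(** Even powers of a generator are squares, so [w] is an odd power, and [phi] is -1 on the
    generator. *)
Lemma mext_phi_nonsquare w : (forall x : F, x ^+ 2 != w) -> mext phi w = -1.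
Proof.
have [->|/mext_unitP[u ->]] := eqVneq w 0.
  by move/(_ 0); rewrite expr0n eqxx.
have /cyclicP[z Dz] := field_unit_group_cyclic [set: {unit F}].
have : u \in [set: {unit F}]%g by rewrite inE.
rewrite Dz mext_val => /cycleP[k ->] nsq.
rewrite lin_charX // (order2_generator Dz) // -signr_odd.
case: (boolP (odd k)) => // ek; case/eqP: (nsq (val (z ^+ k./2)%g)).
rewrite -{2}[k]odd_double_half (negPf ek) add0n -muln2 expgM.
by rewrite [(_ ^+ 2)%g]expgS expg1.
Qed.

Lemma card_sqrt w : #|[pred x : F | x ^+ 2 == w]|%:R = 1 + mext phi w.
Proof.
have [->|nzw] := eqVneq w 0.
  rewrite mext0 addr0 -[RHS]/(1%:R); congr (_%:R); rewrite -(card1 (0 : F)).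
  by apply: eq_card => x; rewrite !inE expf_eq0.
case: (pickP [pred x : F | x ^+ 2 == w]) => [y /= /eqP y2|nsq].
  have nzy : y != 0 by apply: contraNneq nzw => y0; rewrite -y2 y0 expr0n.
  rewrite -y2 mext_exp // phi_sqr // -[RHS]/(2%:R); congr (_%:R).
  rewrite (eq_card (B := pred2 y (- y))) => [|x]; last by rewrite !inE eqf_sqr.
  rewrite card2 -addr_eq0 -mulr2n -mulr_natl mulf_eq0 (negPf two_neq0).
  by rewrite (negPf nzy).
rewrite eq_card0 // mext_phi_nonsquare ?subrr // => x.
by have /= -> := nsq x.
Qed.

(** The fibre of squaring over [w] has [1 + mext phi w] elements; at [w = 0] the value
    [mext phi 0 = 0] accounts for the single root. *)
Lemma sum_sqr (f : F -> algC) :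
  \sum_x f (x ^+ 2) = \sum_w (1 + mext phi w) * f w.
Proof.
rewrite (partition_big (fun x => x ^+ 2) xpredT) //=.
apply: eq_bigr => w _; rewrite -card_sqrt.
under eq_bigr => x /eqP -> do [].
by rewrite sumr_const mulr_natl.
Qed.

(** If [chi / psi] is non-trivial, it has order two and so agrees with [phi] on a generator. *)
Lemma sqrt_char (chi psi : mulCF F) :
    chi \is a linear_char -> psi \is a linear_char ->
  (chi ^+ 2 == psi ^+ 2) = (chi == psi) || (chi == phi * psi).
Proof.
move=> Lchi Lpsi; apply/eqP/orP => [e|[/eqP->|/eqP->]] //; last first.
  by rewrite exprMn phi2 mul1r.
have Upsi := lin_char_unitr Lpsi.
have [r1|r1] := eqVneq (chi / psi) 1.
  by left; rewrite -(divrK Upsi chi) r1 mul1r.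
right; rewrite -(divrK Upsi chi); apply/eqP; congr (_ * _).
have Lr : chi / psi \is a linear_char by rewrite rpredM ?rpredVr.
have r2 : (chi / psi) ^+ 2 = 1 by rewrite exprMn e exprVn divrr ?unitrX.
have /cyclicP[z Dz] := field_unit_group_cyclic [set: {unit F}].
apply/cfun_inP => u _.
have /cycleP[k ->] : u \in <[z]>%g by rewrite -Dz inE.
by rewrite !lin_charX // !(order2_generator Dz).
Qed.

Lemma sum_sqrt_char psi (f : mulCF F -> algC) : psi \is a linear_char ->
  \sum_(R <- mulchars F | R ^+ 2 == psi ^+ 2) f R = f psi + f (phi * psi).
Proof.
move=> Lpsi; rewrite -big_filter.
rewrite (perm_big [:: psi; phi * psi]) /=; last first.
  apply: uniq_perm; first by rewrite filter_uniq ?uniq_mulchars.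
    rewrite /= inE andbT; apply: contra phi_neq1 => /eqP e.
    by rewrite -(mulrK (lin_char_unitr Lpsi) phi) -e divrr ?lin_char_unitr.
  move=> R; rewrite mem_filter mem_mulchars !inE.
  case: (boolP (R \is a linear_char)) => LR; first by rewrite sqrt_char ?andbT.
  rewrite andbF; apply/esym/norP.
  by split; apply: contraNneq LR => ->; rewrite ?rpredM.
by rewrite !big_cons big_nil addr0.
Qed.

End QuadraticCharacter.

(** * Gauss sums *)

Section GaussSums.

Variables (F : finFieldType) (theta : addCF F).
Hypotheses (theta_lin : theta \is a linear_char) (theta_neq1 : theta != 1).
Implicit Types (chi psi : mulCF F) (x y c d : F).
Local Notation g := (gauss theta).
Local Notation lin chi := (chi \is a linear_char).

Lemma addcharD x y : theta (x + y) = theta x * theta y.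
Proof. by rewrite -lin_charM. Qed.

Lemma addchar0 : theta 0 = 1.
Proof. exact: (lin_char1 theta_lin). Qed.

Lemma sum_addchar c : \sum_x theta (c * x) = #|F|%:R * (c == 0)%:R.
Proof.
have [->|nzc] := eqVneq c 0.
  rewrite mulr1; under eq_bigr do rewrite mul0r addchar0.
  by rewrite sumr_const.
rewrite mulr0.
have [y thy] : exists y, theta y != 1.
  apply/existsP; apply: contraR theta_neq1 => /existsPn h.
  by apply/eqP/cfun_inP => x _; rewrite cfun1E inE; apply/eqP/negPn/h.
apply: (mulfI (_ : theta y - 1 != 0)); first by rewrite subr_eq0.
rewrite mulr0 mulrBl mul1r mulr_sumr.
apply/eqP; rewrite subr_eq0; apply/eqP.
(* Translation by [y / c] multiplies the sum by [theta y], which is not 1. *)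
rewrite [RHS](reindex_inj (addrI (y / c))) /=; apply: eq_bigr => x _.
by rewrite mulrDr mulrCA divff // mulr1 addcharD.
Qed.

Lemma gauss1 : g 1 = -1.
Proof.
have := sum_addchar 1; rewrite oner_eq0 mulr0 (bigD1 0) //= mulr0 addchar0.
move/eqP; rewrite addrC addr_eq0 => /eqP <-.
rewrite /gauss (bigD1 0) //= mext0 mul0r add0r.
by apply: eq_bigr => x nzx; rewrite mext1 nzx !mul1r.
Qed.

(** Substitute [x / c] for [x]. At [c = 0] the left side vanishes because [chi] is non-trivial, the
    right side because [0^-1 = 0]. *)
Lemma gauss_twist chi c : lin chi -> chi != 1 ->
  \sum_x mext chi x * theta (c * x) = g chi / mext chi c.
Proof.
move=> Lchi chi1; have [->|nzc] := eqVneq c 0.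
  under eq_bigr do rewrite mul0r addchar0 mulr1.
  by rewrite sum_mext // mext0 invr0 mulr0.
rewrite (reindex_inj (mulfI (_ : c^-1 != 0))) ?invr_eq0 //=.
rewrite /gauss mulr_suml; apply: eq_bigr => x _.
by rewrite mulVKf // mext_mul // mext_inv // -mulrA mulrC.
Qed.

(** The variable of the first Gauss sum is written as [s * y], with [y] the variable of the
    second. *)
Lemma gauss_mul_expand chi psi : lin chi -> lin psi ->
  g chi * g psi =
    \sum_s mext chi s * \sum_y mext (chi * psi) y * theta ((1 + s) * y).
Proof.
move=> Lchi Lpsi; rewrite /gauss mulr_sumr.
under [RHS]eq_bigr do rewrite mulr_sumr.
rewrite exchange_big; apply: eq_bigr => y _ /=.
have [->|nzy] := eqVneq y 0.
  by rewrite mext0 mul0r mulr0 big1 // => s _; rewrite mext0 mul0r mulr0.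
rewrite mulr_suml (reindex_inj (mulIf nzy)) /=; apply: eq_bigr => s _.
by rewrite mextM mext_mul // mulrDl mul1r addcharD; ring.
Qed.

Lemma gauss_mul chi psi : lin chi -> lin psi -> chi * psi != 1 ->
  g chi * g psi = g (chi * psi) * \sum_s mext chi s / mext (chi * psi) (1 + s).
Proof.
move=> Lchi Lpsi nt; rewrite gauss_mul_expand // mulr_sumr.
by apply: eq_bigr => s _; rewrite gauss_twist ?rpredM // mulrCA.
Qed.

(** The substitution s = 1/u - 1 turns the sum of [gauss_mul] into the usual Jacobi sum; the terms
    at [s = -1] and [u = 0] are both zero. *)
Lemma gauss_jacobi chi psi : lin chi -> lin psi -> chi * psi != 1 ->
  g chi * g psi = g (chi * psi) * \sum_u mext psi u * mext chi (1 - u).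
Proof.
move=> Lchi Lpsi nt; rewrite gauss_mul //; congr (_ * _).
rewrite (reindex_inj (addrI (-1))) (reindex_inj invr_inj) /=.
apply: eq_bigr => u _; rewrite addrA subrr add0r.
have [->|nzu] := eqVneq u 0; first by rewrite invr0 !mext0 invr0 mulr0 mul0r.
rewrite (_ : -1 + u^-1 = (1 - u) * u^-1); last by field.
rewrite mext_mul // !mext_inv ?rpredM // invrK mextM.
by have := mext_neq0 Lchi nzu; move: (mext chi u) => z nzz; field.
Qed.

(** In [gauss_mul_expand] the inner sum is now q - 1 at [s = -1] and -1 elsewhere; the constant -1
    disappears on summing [chi] over [s]. *)
Lemma gauss_reflect chi : lin chi -> chi != 1 ->
  g chi * g chi^-1 = mext chi (-1) * #|F|%:R.
Proof.
move=> Lchi chi1; rewrite gauss_mul_expand ?rpredVr // divrr ?lin_char_unitr //.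
have inner s : \sum_y mext 1 y * theta ((1 + s) * y) =
    #|F|%:R * (s == -1)%:R - 1.
  rewrite -addr_eq0 [s + 1]addrC -sum_addchar [in RHS](bigD1 0) //= mulr0.
  rewrite addchar0 [RHS]addrC addKr (bigD1 0) //= mext0 mul0r add0r.
  by apply: eq_bigr => y nzy; rewrite mext1 nzy mul1r.
under eq_bigr do rewrite inner mulrBr mulr1.
rewrite big_split /= sumrN sum_mext // subr0 (bigD1 (-1)) //= eqxx mulr1.
by rewrite big1 ?addr0 // => s /negPf->; rewrite !mulr0.
Qed.

Lemma card_neq0 : #|F|%:R != 0 :> algC.
Proof. by rewrite Num.Theory.pnatr_eq0 -lt0n (ltnW (finNzRing_gt1 F)). Qed.

Lemma gauss_neq0 chi : lin chi -> g chi != 0.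
Proof.
move=> Lchi; have [->|chi1] := eqVneq chi 1.
  by rewrite gauss1 oppr_eq0 oner_eq0.
apply/eqP => g0; have := gauss_reflect Lchi chi1; rewrite g0 mul0r => /esym/eqP.
rewrite mulf_eq0 (negPf card_neq0) orbF (negPf (mext_neq0 _ _)) //.
by rewrite oppr_eq0 oner_eq0.
Qed.

(** * Quadratic Gauss sums and the duplication formula *)

Section Quadratic.

Variable phi : mulCF F.
Hypotheses (phi_lin : lin phi) (phi2 : phi ^+ 2 = 1).
Hypotheses (phi_neq1 : phi != 1) (two_neq0 : 2 != 0 :> F).

Let four_neq0 : 4 != 0 :> F.
Proof. by rewrite -[4%N]/(2 * 2)%N natrM mulf_neq0. Qed.

Lemma mext_phiV x : (mext phi x)^-1 = mext phi x.
Proof.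
have [->|nzx] := eqVneq x 0; first by rewrite mext0 invr0.
apply: (mulfI (mext_neq0 phi_lin nzx)).
by rewrite divff ?mext_neq0 // -expr2 phi_sqr.
Qed.

(** Complete the square, then apply [sum_sqr]. At [c = 0] both sides vanish, the left one because
    [d] is nonzero. *)
Lemma quadratic_gauss c d : d != 0 ->
  \sum_x theta (c * x ^+ 2 + d * x) =
    mext phi c * g phi * theta (- (d ^+ 2 / (4 * c))).
Proof.
move=> nzd; have [->|nzc] := eqVneq c 0.
  under eq_bigr do rewrite mul0r add0r.
  by rewrite sum_addchar (negPf nzd) mext0 mulr0 !mul0r.
rewrite (reindex_inj (addIr (- (d / (2 * c))))) /=.
transitivity (\sum_x theta (c * x ^+ 2) * theta (- (d ^+ 2 / (4 * c)))).
  apply: eq_bigr => x _; rewrite -addcharD; congr (fun_of_cfun theta _).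
  by field; rewrite four_neq0 nzc two_neq0.
rewrite -mulr_suml; congr (_ * _).
rewrite (sum_sqr phi_lin phi2 phi_neq1 two_neq0 (fun w => theta (c * w))).
under eq_bigr do rewrite mulrDl mul1r.
rewrite big_split /= sum_addchar (negPf nzc) mulr0 add0r gauss_twist //.
by rewrite mext_phiV mulrC.
Qed.

(** In the Jacobi sum of [chi] with itself put u = (1 - y)/2, so that u(1 - u) = (1 - y^2)/4;
    [sum_sqr] then yields the Jacobi sum of [phi] and [chi]. *)
Lemma hasse_davenport2 chi : lin chi ->
  g chi * g (phi * chi) = g (chi ^+ 2) * g phi / mext chi 4.
Proof.
move=> Lchi; have four_sq : 4 = 2 ^+ 2 :> F by rewrite -natrX.
(* When [chi ^+ 2] is trivial, [gauss_jacobi] does not apply; then [chi] is 1 or [phi] and the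
   identity is checked directly. *)
have [chi2|chi2] := eqVneq (chi ^+ 2) 1.
  have /orP[/eqP->|/eqP->] : (chi == 1) || (chi == phi * 1).
  - by rewrite -(sqrt_char phi_lin phi2) ?rpred1 // chi2 expr1n.
  - by rewrite mulr1 expr1n mext1 four_neq0 /= divr1.
  rewrite mulr1 -expr2 phi2 four_sq mext_exp // phi_sqr // divr1.
  by rewrite mulrC.
have chi1 : chi != 1 by apply: contraNneq chi2 => ->; rewrite expr1n.
have phichi : phi * chi != 1.
  apply: contraNneq chi2 => e; have := congr1 (fun f => f ^+ 2) e.
  by rewrite exprMn phi2 mul1r expr1n => ->.
apply: (mulfI (gauss_neq0 Lchi)); rewrite mulrA.
rewrite [g chi * g chi]gauss_jacobi -?expr2 //.
rewrite (_ : \sum_u _ = (\sum_u mext phi u * mext chi (1 - u)) / mext chi 4).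
  have := gauss_jacobi Lchi phi_lin; rewrite [chi * phi]mulrC => /(_ phichi).
  move=> e; transitivity (g (chi ^+ 2) * (g chi * g phi) / mext chi 4).
    by rewrite e; ring.
  by ring.
have half_inj : injective (fun y : F => (1 - y) / 2).
  move=> y z /(mulIf (_ : 2^-1 != 0)); rewrite invr_eq0 => /(_ two_neq0).
  by move/addrI/oppr_inj.
rewrite (reindex_inj half_inj) /=.
transitivity (\sum_y mext chi (1 - y ^+ 2) / mext chi 4).
  apply: eq_bigr => y _; rewrite -mext_inv // -!mext_mul //; congr (mext chi _).
  by field; rewrite four_neq0 two_neq0.
rewrite -mulr_suml; congr (_ / _).
rewrite (sum_sqr phi_lin phi2 phi_neq1 two_neq0 (fun w => mext chi (1 - w))).
under [LHS]eq_bigr do rewrite mulrDl mul1r.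
rewrite big_split /= (_ : \sum_w mext chi (1 - w) = 0) ?add0r //.
by rewrite -[RHS](sum_mext Lchi chi1) [RHS](reindex_inj (inv_inj (subKr 1))).
Qed.

(* Opening the Gauss sums g b and g a^-1 turns the left-hand sum into
   \sum_(x, u, w) b w * a^-1 u * theta (w (x^2 - 1) + u (x + i)^2), which is a
   quadratic Gauss sum in x; with w = u k it is then a Gauss sum in u, and
   k = s - 1 gives the right-hand side. *)
Lemma quadratic_transformation (a b : mulCF F) (i : F) :
    lin a -> lin b -> a != 1 -> b != 1 -> phi * b / a != 1 -> i ^+ 2 = -1 ->
  g b * g a^-1 * \sum_x mext a (x + i) ^+ 2 / mext b (x ^+ 2 - 1) =
  mext b (-1) * (g phi * g (phi * b * a^-1) *
    \sum_s mext b s / mext a s / mext b (1 + s)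
           * mext phi (1 - s ^+ 2) * mext a (1 - s ^+ 2)).
Proof.
move=> La Lb a1 b1 pba1 i2.
have nzi : i != 0 by rewrite -sqrf_eq0 i2 oppr_eq0 oner_eq0.
have LaV : lin a^-1 by rewrite rpredVr.
have Lpba : lin (phi * b / a) by rewrite !rpredM.
have aV1 : a^-1 != 1 by rewrite invr_eq1.
transitivity (\sum_u \sum_k mext b (k * u) * mext a^-1 u *
    \sum_x theta (u * (k + 1) * x ^+ 2 + u * (2 * i) * x)
       * theta (- (u * (k + 1)))).
  have expand x : g b * g a^-1 * (mext a (x + i) ^+ 2 / mext b (x ^+ 2 - 1)) =
      \sum_u mext a^-1 u * theta ((x + i) ^+ 2 * u) *
      \sum_w mext b w * theta ((x ^+ 2 - 1) * w).
    rewrite -mulr_suml !gauss_twist // mextV // invrK mext_exp //; ring.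
  rewrite mulr_sumr; under eq_bigr do rewrite expand.
  rewrite exchange_big; apply: eq_bigr => u _ /=.
  have [->|nzu] := eqVneq u 0.
    rewrite !big1 // => k _; first by rewrite mext0 mulr0 mul0r.
    by rewrite mext0 !mul0r.
  under eq_bigr => x _ do rewrite (reindex_inj (mulIf nzu)) mulr_sumr /=.
  rewrite exchange_big; apply: eq_bigr => k _ /=.
  rewrite mulr_sumr; apply: eq_bigr => x _; rewrite -addcharD.
  have -> : u * (k + 1) * x ^+ 2 + u * (2 * i) * x - u * (k + 1) =
      (x + i) ^+ 2 * u + (x ^+ 2 - 1) * (k * u).
    by rewrite sqrrD i2; ring.
  by rewrite addcharD; ring.
transitivity (\sum_k mext b k * mext phi (k + 1) * g phi *
   \sum_u mext (phi * b * a^-1) u * theta (((k + 1)^-1 - (k + 1)) * u)).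
  rewrite exchange_big; apply: eq_bigr => k _; rewrite mulr_sumr.
  apply: eq_bigr => u _; have [->|nzu] := eqVneq u 0.
    by rewrite mulr0 !mext0 !mul0r mulr0.
  (* The linear coefficient [u * (2 * i)] is nonzero, so the formula also covers [k = -1], where the
     quadratic coefficient vanishes. *)
  rewrite -mulr_suml quadratic_gauss //; last first.
    by rewrite !mulf_neq0.
  have [k0|nzk] := eqVneq (k + 1) 0; first by rewrite k0 mulr0 !mext0; ring.
  (* As [i ^+ 2 = -1], completing the square contributes + u/(k + 1). *)
  have -> : theta (((k + 1)^-1 - (k + 1)) * u) =
      theta (- ((u * (2 * i)) ^+ 2 / (4 * (u * (k + 1)))))
      * theta (- (u * (k + 1))).
    rewrite -addcharD; congr (fun_of_cfun theta _).
    rewrite !exprMn i2; field.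
    by rewrite nzk nzu four_neq0.
  by rewrite !mextM !mext_mul //; ring.
rewrite (reindex_inj (addIr (-1))) /= mulr_sumr mulr_sumr.
apply: eq_bigr => s _.
rewrite subrK gauss_twist // mextM mextM mextV //.
have [->|nzs] := eqVneq s 0; first by rewrite !mext0 !(mul0r, mulr0).
have -> : s - 1 = -1 * (1 - s) by ring.
have -> : s^-1 - s = (1 - s) * (1 + s) / s by field.
have -> : 1 - s ^+ 2 = (1 - s) * (1 + s) by ring.
rewrite !mext_mul // !mext_inv // !mext_phiV.
have [->|nzm] := eqVneq (1 - s) 0.
  by rewrite !mext0 ?(mul0r, invr0, mulr0).
have [->|nzp] := eqVneq (1 + s) 0.
  by rewrite !mext0 ?(mul0r, invr0, mulr0).
(* The left side carries the square of [mext phi s]: one factor from [k + 1 = s], one from the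
   denominator of [s^-1 - s]. *)
rewrite -[RHS]mulr1 -(phi_sqr phi2 nzs) !invfM !mext_phiV.
field.
by rewrite !mext_neq0.
Qed.

(** * The product formula over the four powers of a quartic character *)

Section OrderFour.

Variable chi4 : mulCF F.
Hypotheses (chi4_lin : lin chi4) (chi4_sqr : chi4 ^+ 2 = phi).

Lemma inv_chi4 : chi4^-1 = phi * chi4.
Proof.
have U4 := lin_char_unitr chi4_lin.
by apply: (mulrI U4); rewrite divrr // mulrCA -expr2 chi4_sqr -expr2.
Qed.

(** Duplication for [chi] and for [chi4 * chi] leaves [g (chi ^+ 2)] and [g (phi * chi ^+ 2)], to
    which duplication applies once more. *)
Lemma hasse_davenport4 chi : lin chi ->
  g chi * g (phi * chi) * g (chi4 * chi) * g (chi4^-1 * chi) =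
  g phi ^+ 3 / mext chi4 4 * g (chi ^+ 4) / mext chi 4 ^+ 4.
Proof.
move=> Lchi; rewrite inv_chi4 -[phi * chi4 * chi]mulrA -mulrA.
rewrite !hasse_davenport2 ?rpredM // exprMn chi4_sqr mextM.
have := hasse_davenport2 (rpredX 2 Lchi); rewrite -exprM mextX => e.
rewrite -[g (phi * chi ^+ 2)]mul1r.
rewrite -(divff (gauss_neq0 (rpredX 2 Lchi))) [_ * g (phi * _)]mulrAC e.
have nz := gauss_neq0 (rpredX 2 Lchi).
have nz4 := mext_neq0 chi4_lin four_neq0; have nz' := mext_neq0 Lchi four_neq0.
by field; rewrite nz nz4 nz'.
Qed.

(** The constants of [hasse_davenport4] attached to [phi], [chi4] and [chi] cancel in the quotient;
    only a power of [mext psi 4] remains. *)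
Lemma hasse_davenport4_ratio chi psi : lin chi -> lin psi ->
  (g (chi * psi) / g chi) * (g (phi * chi * psi) / g (phi * chi)) *
  (g (chi4 * chi * psi) / g (chi4 * chi)) *
  (g (chi4^-1 * chi * psi) / g (chi4^-1 * chi)) =
  g (chi ^+ 4 * psi ^+ 4) / g (chi ^+ 4) / mext psi 4 ^+ 4.
Proof.
move=> Lchi Lpsi; have Lcp : lin (chi * psi) by rewrite rpredM.
have LV : lin chi4^-1 by rewrite rpredVr.
rewrite -[phi * chi * psi]mulrA -[chi4 * chi * psi]mulrA.
rewrite -[chi4^-1 * chi * psi]mulrA.
transitivity (g (chi * psi) * g (phi * (chi * psi)) * g (chi4 * (chi * psi))
  * g (chi4^-1 * (chi * psi)) / (g chi * g (phi * chi) * g (chi4 * chi)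
  * g (chi4^-1 * chi))).
  have n1 := gauss_neq0 Lchi; have n2 := gauss_neq0 (rpredM phi_lin Lchi).
  have n3 := gauss_neq0 (rpredM chi4_lin Lchi).
  have n4 := gauss_neq0 (rpredM LV Lchi).
  by field; rewrite n1 n2 n3 n4.
rewrite !hasse_davenport4 // mextM exprMn.
have n1 := mext_neq0 Lchi four_neq0; have n2 := mext_neq0 Lpsi four_neq0.
have n3 := mext_neq0 chi4_lin four_neq0.
have n4 := gauss_neq0 (rpredX 4 Lchi); have n5 := gauss_neq0 phi_lin.
by field; rewrite n1 n2 n3 n4 n5.
Qed.

End OrderFour.

Lemma lin_charMV chi psi : lin chi -> lin psi ->
  (chi * psi)^-1 = chi^-1 * psi^-1.
Proof. by move=> Lchi Lpsi; rewrite invrM ?lin_char_unitr // mulrC. Qed.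

(** * Fourth roots of unity and the average over characters *)

Section FourthRoots.

Variable i : F.
Hypothesis i2 : i ^+ 2 = -1.

Lemma sum_fourth_roots (h : F -> algC) :
  \sum_z (z ^+ 4 == 1)%:R * h z = h 1 + h (-1) + h i + h (- i).
Proof.
have nzi : i != 0 by rewrite -sqrf_eq0 i2 oppr_eq0 oner_eq0.
have neqN (z : F) : z != 0 -> z != - z.
  by move=> nz; rewrite -addr_eq0 -mulr2n -mulr_natl mulf_neq0.
have sq1 (z : F) : z ^+ 2 = -1 -> z != 1 /\ z != -1.
  move=> z2; have n1 := neqN 1 (oner_neq0 F).
  by split; apply: contraNneq n1 => z1; rewrite -z2 z1 ?sqrrN expr1n.
have [[i1 iN1] [Ni1 NiN1]] : (i != 1 /\ i != -1) /\ (- i != 1 /\ - i != -1).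
  by split; apply: sq1; rewrite ?sqrrN.
transitivity (\sum_(z <- [:: 1; -1; i; - i]) h z); last first.
  by rewrite !big_cons big_nil addr0 !addrA.
rewrite [RHS]big_uniq /=; last first.
  rewrite /= !inE !negb_or !neqN ?oner_neq0 // (eq_sym 1) (eq_sym (-1)) i1 iN1.
  by rewrite (eq_sym 1) (eq_sym (-1)) Ni1 NiN1.
rewrite big_mkcond [RHS]big_mkcond; apply: eq_bigr => z _ /=.
rewrite -subr_eq0.
have -> : z ^+ 4 - 1 = (z - 1) * (z - -1) * (z - i) * (z - - i).
  transitivity ((z ^+ 2 - 1) * (z ^+ 2 - i ^+ 2)); last by ring.
  by rewrite i2; ring.
rewrite !mulf_eq0 !subr_eq0 !inE !orbA.
by case: ifP => _; rewrite ?mul1r ?mul0r.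
Qed.

(** The four Gauss sums are paired so that each pair of characters has product [be], free of [chi].
    [gauss_mul] then opens them as sums over [s] and [v], and orthogonality in [chi] leaves the
    condition [(s * v) ^+ 4 = 1]. *)
Lemma sum_gauss_quartic (al be : mulCF F) : lin al -> lin be -> be != 1 ->
  \sum_(chi <- mulchars F) g (al * chi ^+ 4) * g (be * chi ^+ 4) *
     g (chi^-1 ^+ 4) * g (be * al^-1 * chi^-1 ^+ 4) =
  (#|F|%:R - 1) * g be ^+ 2 *
  \sum_(z <- [:: 1; -1; i; - i])
    \sum_s mext al s * mext be z / (mext be (1 + s) * mext be (s + z)).
Proof.
move=> La Lb b1.
have cancel chi : lin chi -> al * chi ^+ 4 * (be * al^-1 * chi^-1 ^+ 4) = be.
  move=> Lchi; have Ux := lin_char_unitr Lchi.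
  rewrite mulrC [al * _]mulrC mulrA exprVn divrK ?unitrX //.
  by rewrite divrK // lin_char_unitr.
have cancel' chi : lin chi -> be * chi ^+ 4 * (chi^-1 ^+ 4) = be.
  by move=> Lchi; rewrite exprVn mulrK // unitrX // lin_char_unitr.
transitivity (\sum_(chi <- mulchars F) g be ^+ 2 * \sum_s \sum_v
   mext al s / mext be (1 + s) * (mext be v / mext be (1 + v))
     * mext chi ((s * v) ^+ 4)).
  apply: eq_big_seq => chi; rewrite mem_mulchars => Lchi.
  have [LX LXV] : lin (chi ^+ 4) /\ lin (chi^-1 ^+ 4).
    by split; rewrite rpredX ?rpredVr.
  have LaV : lin al^-1 by rewrite rpredVr.
  transitivity ((g (al * chi ^+ 4) * g (be * al^-1 * chi^-1 ^+ 4)) *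
    (g (be * chi ^+ 4) * g (chi^-1 ^+ 4))); first by ring.
  have [L1 L2] : lin (al * chi ^+ 4) /\ lin (be * chi ^+ 4).
    by split; apply: rpredM.
  have L3 : lin (be * al^-1 * chi^-1 ^+ 4) by rewrite rpredM // rpredM.
  rewrite !gauss_mul ?cancel ?cancel' //.
  rewrite mulrACA -expr2; congr (_ * _).
  rewrite mulr_suml; apply: eq_bigr => s _.
  rewrite mulr_sumr; apply: eq_bigr => v _.
  by rewrite 2!mextM !mextX exprMn mext_mul // !mext_exp //; ring.
rewrite -mulr_sumr [RHS]mulrAC [RHS]mulrC; congr (_ * _).
rewrite exchange_big /= [in RHS]exchange_big /= mulr_sumr.
apply: eq_bigr => s _; rewrite exchange_big /=.
under eq_bigr do rewrite -mulr_sumr sum_mulchars.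
have [->|nzs] := eqVneq s 0.
  rewrite !big1 ?mulr0 // => *; first by rewrite mext0 !mul0r.
  by rewrite mext0 !mul0r.
(* With [v = s^-1 * z] the condition says that [z] is a fourth root of unity. *)
rewrite (reindex_inj (mulfI (_ : s^-1 != 0))) ?invr_eq0 //=.
rewrite !big_cons big_nil addr0 !addrA -(sum_fourth_roots (fun z =>
  mext al s * mext be z / (mext be (1 + s) * mext be (s + z)))) mulr_sumr.
apply: eq_bigr => z _; rewrite mulVKf //.
rewrite (_ : 1 + s^-1 * z = s^-1 * (s + z)); last by field.
rewrite !mext_mul // mext_inv // !invfM invrK.
have := mext_neq0 Lb nzs.
move: (mext be s) (mext be (1 + s))^-1 (mext be (s + z))^-1 => b c d nzb.
by field.
Qed.

End FourthRoots.

(** * The hypergeometric functions as character sums *)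

(** The parameters form four cosets of the group generated by [chi4], and [hasse_davenport4_ratio]
    applies to each. The powers of [mext chi 4] cancel between the upper and lower parameters. *)
Lemma hyperF8_expand (chi4 A B : mulCF F) (i : F) :
    lin chi4 -> chi4 ^+ 2 = phi -> lin A -> lin B ->
    B ^+ 4 != 1 -> i ^+ 2 = -1 ->
  hyperF theta
    [tuple A; phi * A; chi4 * A; chi4^-1 * A;
           B; phi * B; chi4 * B; chi4^-1 * B]
    [tuple 1; phi; chi4; chi4^-1;
           A * B^-1; phi * A * B^-1; chi4 * A * B^-1; chi4^-1 * A * B^-1] 1 =
  g (B ^+ 4) / (g (A ^+ 4) * g (B ^+ 4 * (A ^+ 4)^-1)) *
  \sum_(z <- [:: 1; -1; i; - i]) \sum_s mext (A ^+ 4) s * mext (B ^+ 4) z /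
     (mext (B ^+ 4) (1 + s) * mext (B ^+ 4) (s + z)).
Proof.
move=> L4 chi4_sqr LA LB B1 i2.
have phiV := invr_phi phi_lin phi2.
have L4V : lin chi4^-1 by rewrite rpredVr.
have LD : lin (A * B^-1) by rewrite rpredM ?rpredVr.
have LDV : lin (A * B^-1)^-1 by rewrite rpredVr.
have D4 : (A * B^-1)^-1 ^+ 4 = B ^+ 4 * (A ^+ 4)^-1.
  by rewrite lin_charMV ?rpredVr // invrK exprMn exprVn mulrC.
rewrite /hyperF.
(* The minus sign comes from [g 1 = -1] at the trivial lower parameter; it cancels the sign in front
   of the hypergeometric sum. *)
rewrite (eq_big_seq (fun chi => - (g (A ^+ 4) * g (B ^+ 4)
   * g (B ^+ 4 * (A ^+ 4)^-1))^-1 *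
   (g (A ^+ 4 * chi ^+ 4) * g (B ^+ 4 * chi ^+ 4) *
     g (chi^-1 ^+ 4) * g (B ^+ 4 * (A ^+ 4)^-1 * chi^-1 ^+ 4)))).
  rewrite -mulr_sumr (sum_gauss_quartic i2) ?rpredX //.
  have q1 : #|F|%:R - 1 != 0 :> algC.
    by rewrite subr_eq0 Num.Theory.pnatr_eq1 gtn_eqF ?finNzRing_gt1.
  have n1 := gauss_neq0 (rpredX 4 LA); have n2 := gauss_neq0 (rpredX 4 LB).
  have n3 : g (B ^+ 4 * (A ^+ 4)^-1) != 0.
    by rewrite gauss_neq0 // rpredM ?rpredVr ?rpredX.
  by field; rewrite n1 n2 n3 q1.
move=> chi; rewrite mem_mulchars => Lchi.
have LV : lin chi^-1 by rewrite rpredVr.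
rewrite !big_ord_recl big_ord0 /= !(tnth_nth 0) /=.
rewrite -!(mulrA _ A B^-1) mext_1 // -mext_exp //.
rewrite (_ : (-1) ^+ 8 = 1 :> F); last by ring.
rewrite mext_1 // !mulr1.
rewrite [(phi * chi)^-1]lin_charMV // [(chi4 * chi)^-1]lin_charMV //.
rewrite [(chi4^-1 * chi)^-1]lin_charMV // mul1r.
rewrite [(A * B^-1 * chi)^-1]lin_charMV //.
rewrite [(phi * (A * B^-1) * chi)^-1]lin_charMV // ?(rpredM _ LD) //.
rewrite [(chi4 * (A * B^-1) * chi)^-1]lin_charMV // ?(rpredM _ LD) //.
rewrite [(chi4^-1 * (A * B^-1) * chi)^-1]lin_charMV // ?(rpredM _ LD) //.
rewrite [(phi * (A * B^-1))^-1]lin_charMV //.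
rewrite [(chi4 * (A * B^-1))^-1]lin_charMV //.
rewrite [(chi4^-1 * (A * B^-1))^-1]lin_charMV // phiV !invrK invr1.
have rA := hasse_davenport4_ratio L4 chi4_sqr LA Lchi.
have rB := hasse_davenport4_ratio L4 chi4_sqr LB Lchi.
have := hasse_davenport4_ratio L4 chi4_sqr (rpred1 _) LV.
rewrite mul1r !mulr1 expr1n mul1r gauss1 => r1.
have := hasse_davenport4_ratio L4 chi4_sqr LDV LV; rewrite D4 => rD.
set d := (A * B^-1)^-1 in rD *.
transitivity (
  (g (A * chi) / g A * (g (phi * A * chi) / g (phi * A)) *
  (g (chi4 * A * chi) / g (chi4 * A)) *
  (g (chi4^-1 * A * chi) / g (chi4^-1 * A))) *
  (g (B * chi) / g B * (g (phi * B * chi) / g (phi * B)) *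
  (g (chi4 * B * chi) / g (chi4 * B)) *
  (g (chi4^-1 * B * chi) / g (chi4^-1 * B))) *
  (g chi^-1 / -1 * (g (phi * chi^-1) / g phi) *
  (g (chi4 * chi^-1) / g chi4) * (g (chi4^-1 * chi^-1) / g chi4^-1)) *
  (g (d * chi^-1) / g d * (g (phi * d * chi^-1) / g (phi * d)) *
  (g (chi4 * d * chi^-1) / g (chi4 * d)) *
  (g (chi4^-1 * d * chi^-1) / g (chi4^-1 * d)))).
  by ring.
rewrite rA rB r1 rD mextV // !invfM.
have := mext_neq0 Lchi four_neq0; move: (mext chi 4) => c nzc.
have n1 := gauss_neq0 (rpredX 4 LA); have n2 := gauss_neq0 (rpredX 4 LB).
have n3 : g (B ^+ 4 * (A ^+ 4)^-1) != 0.
  by rewrite gauss_neq0 // rpredM ?rpredVr ?rpredX.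
by field; rewrite n1 n2 n3 nzc.
Qed.

(** Duplication merges [D] with [phi * D] and the lower parameters 1 with [phi]; the two remaining
    Gauss sums have characters with product [phi * R^-1 ^+ 2]. The resulting sum over [s] depends on
    [R] only through [R ^+ 2]. *)
Lemma hyper3F2_expand (R D : mulCF F) : lin R -> lin D ->
    R ^+ 2 != phi -> D ^+ 2 != 1 -> mext phi (-1) = 1 ->
  hyper3F2 theta (R * phi * R^-1 ^+ 2) D (phi * D) R phi 1 =
  g (phi * R^-1 ^+ 2) * mext R (-1) / (mext R 4 * g (R^-1 ^+ 2) * g phi) *
  \sum_s mext (D ^+ 2) s / mext (R ^+ 2) s / mext (D ^+ 2) (1 + s)
           * mext phi (1 - s ^+ 2) * mext (R ^+ 2) (1 - s ^+ 2).
Proof.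
move=> LR LD R2 D2 phiN1.
have phiV := invr_phi phi_lin phi2.
have LRV : lin R^-1 by rewrite rpredVr.
have UR := lin_char_unitr LR.
have -> : R * phi * R^-1 ^+ 2 = phi * R^-1.
  by rewrite [R * phi]mulrC -mulrA expr2 mulVKr.
have q1 : #|F|%:R - 1 != 0 :> algC.
  by rewrite subr_eq0 Num.Theory.pnatr_eq1 gtn_eqF ?finNzRing_gt1.
set T := \sum_s _.
have cancel (chi : mulCF F) : lin chi ->
    phi * R^-1 * chi * (R^-1 * chi^-1) = phi * R^-1 ^+ 2.
  by move=> /lin_char_unitr Ux; rewrite mulrACA divrr // mulr1 -mulrA -expr2.
have sumT : \sum_(chi <- mulchars F) g (phi * R^-1 * chi) * g (R^-1 * chi^-1) *
     (g (D ^+ 2 * chi ^+ 2) * g (chi^-1 ^+ 2)) * mext chi (-1) =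
   (#|F|%:R - 1) * (g (phi * R^-1 ^+ 2) * g (D ^+ 2) * mext R (-1) * T).
  transitivity (\sum_(chi <- mulchars F) g (phi * R^-1 ^+ 2) * g (D ^+ 2) *
     \sum_s \sum_u mext (D ^+ 2) s / mext (D ^+ 2) (1 + s) *
       (mext (phi * R^-1) u / mext (phi * R^-1 ^+ 2) (1 + u))
       * mext chi (- (s ^+ 2 * u))).
    apply: eq_big_seq => chi; rewrite mem_mulchars => Lchi.
    have LV : lin chi^-1 by rewrite rpredVr.
    have Ux := lin_char_unitr Lchi.
    have c1 := cancel chi Lchi.
    have c2 : D ^+ 2 * chi ^+ 2 * chi^-1 ^+ 2 = D ^+ 2.
      by rewrite exprVn mulrK ?unitrX.
    have nt : phi * R^-1 ^+ 2 != 1.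
      apply: contraNneq R2 => e; rewrite -(mulr1 (R ^+ 2)) -e mulrCA exprVn.
      by rewrite divrr ?unitrX // mulr1.
    have L1 : lin (phi * R^-1 * chi) by rewrite rpredM // rpredM.
    have L2 : lin (R^-1 * chi^-1) by rewrite rpredM.
    have L3 : lin (D ^+ 2 * chi ^+ 2) by rewrite rpredM ?rpredX.
    have L4 : lin (chi^-1 ^+ 2) by rewrite rpredX.
    rewrite [g (phi * R^-1 * chi) * _]gauss_mul ?c1 //.
    rewrite [g (D ^+ 2 * _) * _]gauss_mul ?c2 // mulrACA -[LHS]mulrA.
    congr (_ * _).
    rewrite mulrAC mulrC mulr_suml; apply: eq_bigr => s _.
    rewrite mulr_suml mulr_sumr; apply: eq_bigr => u _.
    rewrite -[- (s ^+ 2 * u)]mulN1r (mext_mul Lchi (-1)).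
    rewrite (mext_mul Lchi (s ^+ 2)) mext_exp //.
    by rewrite mextM [mext (_ * chi) _]mextM (mextX chi 1); ring.
  rewrite -mulr_sumr exchange_big /=.
  transitivity (g (phi * R^-1 ^+ 2) * g (D ^+ 2) *
    ((#|F|%:R - 1) * mext R (-1) * T)); last by ring.
  congr (_ * _); rewrite mulr_sumr; apply: eq_bigr => s _.
  rewrite exchange_big /=; under eq_bigr do rewrite -mulr_sumr sum_mulchars.
  have [->|nzs] := eqVneq s 0.
    by rewrite big1 => [|u _]; rewrite !mext0 !mul0r ?mulr0.
  have nzs2 : s ^+ 2 != 0 by rewrite expf_neq0.
  (* Orthogonality leaves the single [u] with [- (s ^+ 2 * u) = 1]; then 1 + u = -(1 - s^2)/s^2. *)
  rewrite (bigD1 (- (s ^+ 2)^-1)) //= big1 ?addr0; last first.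
    move=> u nu; case: eqP => [e|_]; last by rewrite !mulr0.
    case/eqP: nu; apply: (mulfI nzs2); rewrite mulrN divff //.
    by apply: oppr_inj; rewrite opprK.
  rewrite mulrN divff // opprK eqxx mulr1.
  have -> : 1 - (s ^+ 2)^-1 = -1 * (1 - s ^+ 2) / s ^+ 2 by field.
  have -> : - (s ^+ 2)^-1 = -1 / s ^+ 2 by rewrite mulN1r.
  rewrite !mextM !mext_mul // mextV // !mext_inv // !mext_exp //.
  have [->|nz1] := eqVneq (1 - s ^+ 2) 0.
    by rewrite !mext0 !(mul0r, mulr0, invr0).
  have rV : (mext R (-1))^-1 = mext R (-1) by rewrite -mext_inv // invrN1.
  have r2 : mext R (-1) ^+ 2 = 1 by rewrite -mext_exp // sqrrN expr1n mext_1.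
  rewrite -[RHS]mulr1 -r2 !mextV // phiN1 phi_sqr // divr1 !invfM !invrK.
  rewrite !rV !mext_phiV !invr1.
  have := mext_neq0 LR nzs; have := mext_neq0 LR nz1.
  move: (mext R s) (mext R (1 - s ^+ 2)) (mext D (1 + s))^-1 => x y z nzy nzx.
  by field.
rewrite /hyper3F2 /hyperF.
rewrite (eq_big_seq (fun chi =>
  - (mext R 4 * g (R^-1 ^+ 2) * g phi * g (D ^+ 2))^-1 *
   (g (phi * R^-1 * chi) * g (R^-1 * chi^-1) *
     (g (D ^+ 2 * chi ^+ 2) * g (chi^-1 ^+ 2)) * mext chi (-1)))).
  rewrite -mulr_sumr sumT.
  have n1 := gauss_neq0 (rpredX 2 LRV); have n2 := gauss_neq0 (rpredX 2 LD).
  have n3 := gauss_neq0 phi_lin; have n4 := mext_neq0 LR four_neq0.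
  by field; rewrite n1 n2 n3 n4 q1.
move=> chi; rewrite mem_mulchars => Lchi.
have LV : lin chi^-1 by rewrite rpredVr.
rewrite !big_ord_recl big_ord0 /= !(tnth_nth 0) /=.
rewrite mext_1 // -mext_exp // (_ : (-1) ^+ 3 = -1 :> F); last by ring.
rewrite [(phi * chi)^-1]lin_charMV // [(R * chi)^-1]lin_charMV // mul1r.
rewrite phiV invr1 gauss1.
have h1 := hasse_davenport2 LRV; have h2 := hasse_davenport2 LD.
have h3 := hasse_davenport2 LV; have h4 := hasse_davenport2 (rpredM LD Lchi).
rewrite -[phi * D * chi]mulrA.
have LpR : lin (phi * R^-1) by rewrite rpredM.
have n1 := gauss_neq0 LRV; have n2 := gauss_neq0 LpR; have n3 := gauss_neq0 LD.
have n4 := gauss_neq0 (rpredM phi_lin LD); have n5 := gauss_neq0 phi_lin.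
transitivity (- (g (phi * R^-1 * chi) * g (R^-1 * chi^-1) *
  (g (D * chi) * g (phi * (D * chi))) * (g chi^-1 * g (phi * chi^-1)) *
  mext chi (-1)) / (g R^-1 * g (phi * R^-1) * (g D * g (phi * D)) * g phi)).
  by field; rewrite n1 n2 n3 n4 n5.
rewrite h1 h2 h3 h4 mextM !mextV // exprMn.
have m1 := mext_neq0 LR four_neq0; have m2 := mext_neq0 Lchi four_neq0.
have m3 := mext_neq0 LD four_neq0; have n6 := gauss_neq0 (rpredX 2 LD).
have n7 := gauss_neq0 (rpredX 2 LRV).
by field; rewrite m1 m2 m3 n5 n6 n7.
Qed.

(** * The sums attached to the four fourth roots of unity *)

(** At z = 1 the two denominators coincide and combine to [B ^+ 8], which is the shape of
    [gauss_mul]. *)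
Lemma quartic_sum1 (A B : mulCF F) : lin A -> lin B -> B ^+ 8 != 1 ->
  g (A ^+ 4) * g (A^-1 ^+ 4 * B ^+ 8) = g (B ^+ 8) *
  \sum_s mext (A ^+ 4) s * mext (B ^+ 4) 1 /
    (mext (B ^+ 4) (1 + s) * mext (B ^+ 4) (s + 1)).
Proof.
move=> LA LB B8; have LAV : lin A^-1 by rewrite rpredVr.
have e : A ^+ 4 * (A^-1 ^+ 4 * B ^+ 8) = B ^+ 8.
  by rewrite exprVn mulVKr // unitrX // lin_char_unitr.
rewrite gauss_mul ?e ?rpredX // ?rpredM ?rpredX //; congr (_ * _).
apply: eq_bigr => s _; rewrite [s + 1]addrC !mextX mext_1 // expr1n mulr1.
by rewrite -exprD.
Qed.

(** At z = -1 the summand is a function of [s ^+ 2], since (1 + s)(s - 1) = -(1 - s^2); the two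
    parts of the weight in [sum_sqr] give the characters [A ^+ 2] and [phi * A ^+ 2]. *)
Lemma quartic_sumN1 (A B : mulCF F) : lin A -> lin B -> B ^+ 4 != 1 ->
    mext phi (-1) = 1 ->
  g (A ^+ 2) * g ((A ^+ 2)^-1 * B ^+ 4)
    + g (phi * A ^+ 2) * g ((phi * A ^+ 2)^-1 * B ^+ 4) =
  g (B ^+ 4) *
  \sum_s mext (A ^+ 4) s * mext (B ^+ 4) (-1) /
    (mext (B ^+ 4) (1 + s) * mext (B ^+ 4) (s + -1)).
Proof.
move=> LA LB B4 phiN1; have LA2 : lin (A ^+ 2) by rewrite rpredX.
have LB4 : lin (B ^+ 4) by rewrite rpredX.
have main R : lin R -> mext R (-1) = 1 ->
    g R * g (R^-1 * B ^+ 4) =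
    g (B ^+ 4) * \sum_w mext R w / mext (B ^+ 4) (1 - w).
  move=> LR RN1; have LRV : lin R^-1 by rewrite rpredVr.
  have e : R * (R^-1 * B ^+ 4) = B ^+ 4 by rewrite mulVKr // lin_char_unitr.
  rewrite gauss_mul ?e ?(rpredM LRV) //; congr (_ * _).
  rewrite (reindex_inj oppr_inj) /=; apply: eq_bigr => w _.
  by rewrite -mulN1r mext_mul // RN1 mul1r mulN1r.
rewrite !main ?rpredM ?(mext_evenX_N1 LA 0) //; last first.
  by rewrite mextM phiN1 (mext_evenX_N1 LA 0) // mulr1.
rewrite -mulrDr -big_split /=; congr (_ * _).
transitivity (\sum_x mext (A ^+ 2) (x ^+ 2) / mext (B ^+ 4) (1 - x ^+ 2)).
  rewrite (sum_sqr phi_lin phi2 phi_neq1 two_neq0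
    (fun w => mext (A ^+ 2) w / mext (B ^+ 4) (1 - w))).
  by apply: eq_bigr => w _; rewrite [mext (phi * _) w]mextM; ring.
apply: eq_bigr => s _.
rewrite (mext_evenX_N1 LB 1) // mulr1 -mext_mul // !mextX mext_exp // -exprM.
congr (_ / _).
rewrite (_ : (1 + s) * (s + -1) = -1 * (1 - s ^+ 2)); last by ring.
by rewrite mext_mul // exprMn -(mextX B 3 (-1)) (mext_evenX_N1 LB 1) // mul1r.
Qed.

Lemma quartic_sum_sqrtN1 (A B : mulCF F) (z : F) :
    lin A -> lin B -> z ^+ 2 = -1 ->
  \sum_s mext (A ^+ 4) s * mext (B ^+ 4) z /
    (mext (B ^+ 4) (1 + s) * mext (B ^+ 4) (s + z)) =
  mext B 16 / mext A (- 4) *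
  \sum_x mext (A ^+ 2) (x + - z) ^+ 2 / mext (B ^+ 4) (x ^+ 2 - 1).
Proof.
(* The affine map s = c(x - z) sends x = -1 and x = 1 to the zeros -1 and -z of the denominators.
   Its scale satisfies c^4 = -1/4, which produces the constants at 16 and -4. *)
move=> LA LB z2; pose c := (1 - z) / 2.
have sixteen_neq0 : 16 != 0 :> F by rewrite -[16%N]/(4 * 4)%N natrM mulf_neq0.
have c4 : c ^+ 4 = (- 4)^-1.
  transitivity ((1 - 2 * z + z ^+ 2) ^+ 2 / 4 ^+ 2).
    by rewrite /c; field; rewrite two_neq0 sixteen_neq0.
  rewrite z2 (_ : (1 - 2 * z + -1) ^+ 2 = 4 * z ^+ 2); last by ring.
  by rewrite z2; field; rewrite sixteen_neq0 oppr_eq0 four_neq0.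
have nzc : c != 0.
  apply: contraNneq four_neq0 => c0; move/esym/eqP: c4.
  by rewrite c0 expr0n invr_eq0 oppr_eq0.
have zB : mext (B ^+ 4) z = 1.
  by rewrite mextX -mext_exp // (exprM z 2 2) z2 sqrrN expr1n mext_1.
rewrite (reindex_inj (mulfI nzc)) (reindex_inj (addIr (- z))) /= mulr_sumr.
apply: eq_bigr => x _; rewrite zB mulr1.
have cz : c * (x - z) = c * x - (1 + z) / 2.
  rewrite mulrBr; congr (_ - _); transitivity ((z - z ^+ 2) / 2); last first.
    by rewrite z2 opprK addrC.
  by rewrite /c; field; rewrite two_neq0.
have -> : 1 + c * (x - z) = c * (x + 1).
  by rewrite cz /c; field; rewrite two_neq0.
have -> : c * (x - z) + z = c * (x - 1).
  by rewrite cz /c; field; rewrite two_neq0.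
rewrite (_ : x ^+ 2 - 1 = (x + 1) * (x - 1)); last by ring.
clearbody c.
rewrite !mextX !mext_mul // !exprMn -(mext_exp LA 4 c) -(mext_exp LB 4 c) c4.
rewrite !mext_inv // (_ : 16 = (-4) ^+ 2); last by ring.
rewrite (mext_exp LB) // !invfM !invrK.
move: (mext B (x + 1) ^+ 4)^-1 (mext B (x - 1) ^+ 4)^-1 => u v; ring.
Qed.

End Quadratic.

End GaussSums.

(** * Assembly of the three terms *)

Theorem corollary5p3 (F : finFieldType) (hq : #|F| = 1 %[mod 4])
    (theta : addCF F) (theta_lin : theta \is a linear_char)
    (theta_neq1 : theta != 1)
    (phi : mulCF F) (phi_lin : phi \is a linear_char)
    (phi_ord : #[phi]%CF = 2%N)
    (chi4 : mulCF F) (chi4_lin : chi4 \is a linear_char)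
    (chi4_ord : #[chi4]%CF = 4%N)
    (A B : mulCF F) (A_lin : A \is a linear_char) (B_lin : B \is a linear_char)
    (hA : A ^+ 4 != 1) (hB : B ^+ 8 != 1) (hAB : A ^+ 2 != phi * B ^+ 4) :
  let g := gauss theta in
  hyperF theta
    [tuple A; phi * A; chi4 * A; chi4^-1 * A;
           B; phi * B; chi4 * B; chi4^-1 * B]
    [tuple 1; phi; chi4; chi4^-1;
           A * B^-1; phi * A * B^-1; chi4 * A * B^-1; chi4^-1 * A * B^-1]
    1
  = g (B ^+ 4) * g (A^-1 ^+ 4 * B ^+ 8) / (g (A^-1 ^+ 4 * B ^+ 4) * g (B ^+ 8))
    + \sum_(R <- mulchars F | R ^+ 2 == A ^+ 4)
        g (A^-1 ^+ 4) * g (R^-1 * B ^+ 4)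
        / (g R^-1 * g (A^-1 ^+ 4 * B ^+ 4))
    + g (A^-1 ^+ 2) * g (A^-1 ^+ 2 * phi * B ^+ 4)
      / (g (A^-1 ^+ 2 * B ^+ 2) * g (A^-1 ^+ 2 * phi * B ^+ 2))
      * \sum_(R <- mulchars F | R ^+ 2 == A ^+ 2)
          hyper3F2 theta (R * phi * A^-1 ^+ 2) (B ^+ 2) (phi * B ^+ 2) R phi 1.
Proof.
move=> g.
have [i i2 two_neq0] := sqrtN1_exists hq.
have phi2 : phi ^+ 2 = 1 by rewrite -phi_ord exp_cforder.
have phi_neq1 : phi != 1.
  by rewrite -[phi]expr1 -dvdn_cforder phi_ord.
(* [chi4 ^+ 2] is a square root of the trivial character, hence 1 or [phi], and order 4 excludes
   1. *)
have chi4_sqr : chi4 ^+ 2 = phi.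
  have : (chi4 ^+ 2) ^+ 2 == 1 ^+ 2.
    by rewrite -exprM -[(2 * 2)%N]chi4_ord exp_cforder expr1n.
  rewrite (sqrt_char phi_lin phi2) ?rpredX ?rpred1 // mulr1.
  by rewrite -dvdn_cforder chi4_ord => /eqP.
have phiN1 : mext phi (-1) = 1.
  rewrite -i2 mext_exp // (phi_sqr phi2) //.
  by rewrite -sqrf_eq0 i2 oppr_eq0 oner_eq0.
have B4 : B ^+ 4 != 1.
  by apply: contraNneq hB => e; rewrite (exprM B 4 2) e expr1n.
have UA := lin_char_unitr A_lin.
have [LA2 LA4] : A ^+ 2 \is a linear_char /\ A ^+ 4 \is a linear_char.
  by split; apply: rpredX.
have [LB2 LB4] : B ^+ 2 \is a linear_char /\ B ^+ 4 \is a linear_char.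
  by split; apply: rpredX.
have LpA2 : phi * A ^+ 2 \is a linear_char by rewrite rpredM.
have A2 : A ^+ 2 != 1.
  by apply: contraNneq hA => e; rewrite (exprM A 2 2) e expr1n.
have A2phi : A ^+ 2 != phi.
  by apply: contraNneq hA => e; rewrite (exprM A 2 2) e phi2.
(* This is where [hAB] enters: it is the non-triviality required by [quadratic_transformation] for
   [A ^+ 2] and [B ^+ 4]. *)
have nt : phi * B ^+ 4 * (A ^+ 2)^-1 != 1.
  apply: contra hAB => /eqP e.
  by rewrite -[phi * B ^+ 4](divrK (unitrX 2 UA)) e mul1r.
have four_neq0 : 4 != 0 :> F by rewrite -[4%N]/(2 * 2)%N natrM mulf_neq0.
rewrite (hyperF8_expand theta_lin theta_neq1 phi_lin phi2 phi_neq1 two_neq0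
  chi4_lin chi4_sqr A_lin B_lin B4 i2) -/g.
rewrite !big_cons big_nil addr0.
rewrite (quartic_sum_sqrtN1 two_neq0 A_lin B_lin i2).
rewrite (quartic_sum_sqrtN1 two_neq0 (z := - i) A_lin B_lin) ?sqrrN // opprK.
have e1 := quartic_sum1 theta_lin A_lin B_lin hB.
have eN1 := quartic_sumN1 theta_lin phi_lin phi2 phi_neq1 two_neq0
  A_lin B_lin B4 phiN1.
have key := quadratic_transformation theta_lin theta_neq1 phi_lin phi2 phi_neq1
  two_neq0 LA2 LB4 A2 B4 nt.
(* Both instances have the same right-hand side, so [i] and [- i] contribute equally. *)
have keyp := key i i2; have := key (- i); rewrite sqrrN => /(_ i2) keyn.
rewrite (mext_evenX_N1 B_lin 1) mul1r in keyp keyn.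
rewrite (exprM A 2 2) !(sum_sqrt_char phi_lin phi2 phi_neq1) // -exprM.
rewrite -[(2 * 2)%N]/4%N !exprVn.
set S1 := \sum_s _ in e1 *; set SN1 := \sum_s _ in eN1 *.
set Vn := \sum_x _ in keyn *; set Vp := \sum_x _ in keyp *.
rewrite -/g in e1 eN1 keyp keyn; rewrite exprVn in e1.
set T := \sum_s _ in keyn; rewrite -/T in keyp.
have LA2V : (A ^+ 2)^-1 \is a linear_char by rewrite rpredVr.
have LA4V : (A ^+ 4)^-1 \is a linear_char by rewrite rpredVr.
have LpA2V : (phi * A ^+ 2)^-1 \is a linear_char by rewrite rpredVr.
have g0 chi : chi \is a linear_char -> g chi != 0 by apply: gauss_neq0.
have pA2 : phi * A ^+ 2 != 1.
  apply: contraNneq A2phi => e.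
  by rewrite -(mul1r (A ^+ 2)) -phi2 expr2 -mulrA e mulr1.
have reflect chi : chi \is a linear_char -> chi != 1 -> mext chi (-1) = 1 ->
  g chi * g chi^-1 = #|F|%:R.
  by move=> L n e; rewrite [LHS]gauss_reflect // e mul1r.
have q0 : #|F|%:R != 0 :> algC by apply: card_neq0.
have divE (u v w : algC) : u != 0 -> u * v = w -> v = w / u.
  by move=> nu <-; rewrite mulrAC divff // mul1r.
have r4 := reflect _ LA4 hA (mext_evenX_N1 A_lin 1).
have r2 := reflect _ LA2 A2 (mext_evenX_N1 A_lin 0).
have rp : g (phi * A ^+ 2) * g (phi * A ^+ 2)^-1 = #|F|%:R.
  by apply: reflect => //; rewrite mextM phiN1 (mext_evenX_N1 A_lin 0) // mulr1.
have rphi : g phi * g phi = #|F|%:R.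
  rewrite -(reflect phi) //; congr (_ * g _).
  by rewrite (invr_phi phi_lin phi2).
have LBA : B ^+ 4 * (A ^+ 4)^-1 \is a linear_char by rewrite rpredM.
rewrite [(A ^+ 4)^-1 * B ^+ 4]mulrC.
have t1 : g (B ^+ 4) / (g (A ^+ 4) * g (B ^+ 4 * (A ^+ 4)^-1)) * S1 =
    g (B ^+ 4) * g ((A ^+ 4)^-1 * B ^+ 8) /
      (g (B ^+ 4 * (A ^+ 4)^-1) * g (B ^+ 8)).
  have n8 := g0 _ (rpredX 8 B_lin).
  have -> : S1 = g (A ^+ 4) * g ((A ^+ 4)^-1 * B ^+ 8) / g (B ^+ 8).
    by rewrite e1 mulrAC divff // mul1r.
  by field; rewrite n8 !g0.
have tN1 : g (B ^+ 4) / (g (A ^+ 4) * g (B ^+ 4 * (A ^+ 4)^-1)) * SN1 =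
    g (A ^+ 4)^-1 * g ((A ^+ 2)^-1 * B ^+ 4) /
      (g (A ^+ 2)^-1 * g (B ^+ 4 * (A ^+ 4)^-1)) +
    g (A ^+ 4)^-1 * g ((phi * A ^+ 2)^-1 * B ^+ 4) /
      (g (phi * A ^+ 2)^-1 * g (B ^+ 4 * (A ^+ 4)^-1)).
  (* Each Gauss sum of an inverse is written as q over the Gauss sum of the character; the powers of
     q then cancel. *)
  rewrite (divE _ _ _ (g0 _ LA4) r4) (divE _ _ _ (g0 _ LA2) r2).
  rewrite (divE _ _ _ (g0 _ LpA2) rp).
  have -> : SN1 = (g (B ^+ 4) * SN1) / g (B ^+ 4).
    by rewrite mulrAC divff ?mul1r ?g0.
  by rewrite -eN1; field; rewrite q0 !g0.
rewrite !mulrDr t1 tN1 -!addrA; congr (_ + (_ + (_ + _))).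
(* The constant [mext R (-1) / mext R 4] is the same for [A] and [phi * A], as [phi] is 1 at -1 and
   at the square 4; so the two 3F2 values coincide. *)
have hF R : R \is a linear_char -> R ^+ 2 = A ^+ 2 ->
    mext R (-1) / mext R 4 = mext A (-1) / mext A 4 ->
  hyper3F2 theta (R * phi * (A ^+ 2)^-1) (B ^+ 2) (phi * B ^+ 2) R phi 1 =
    g (phi * (A ^+ 2)^-1) * (mext A (-1) / mext A 4)
      / (g (A ^+ 2)^-1 * g phi) * T.
  move=> LR R2 eR; rewrite -eR -R2 -exprVn hyper3F2_expand //; last 2 first.
  - by rewrite R2.
  - by rewrite -exprM.
  rewrite -/g R2 -exprM -[(2 * 2)%N]/4%N -/T.
  have n1 := g0 _ phi_lin; have n2 := mext_neq0 LR four_neq0.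
  have n3 := g0 _ (rpredX 2 (rpredVr LR)).
  by field; rewrite n1 n2 n3.
rewrite !hF ?rpredM ?exprMn ?phi2 ?mul1r //; last first.
  have four_sq : 4 = 2 ^+ 2 :> F by rewrite -natrX.
  by rewrite !mextM phiN1 four_sq (mext_exp phi_lin) phi_sqr // !mul1r.
rewrite [(A ^+ 2)^-1 * phi]mulrC -[phi * _ * B ^+ 2]mulrA.
rewrite [phi * _ * B ^+ 4]mulrAC.
have L2 : (A ^+ 2)^-1 * B ^+ 2 \is a linear_char by rewrite rpredM.
have LpA : phi * (A ^+ 2)^-1 \is a linear_char by rewrite rpredM.
(* [hd1] merges the denominator in front of the 3F2 sum; [hd2] eliminates
   [g (phi * (A ^+ 2)^-1)]. *)
have hd1 := hasse_davenport2 theta_lin theta_neq1 phi_lin phi2 phi_neq1 two_neq0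
  L2.
have hd2 := hasse_davenport2 theta_lin theta_neq1 phi_lin phi2 phi_neq1 two_neq0
  LA2V.
rewrite exprMn exprVn -!exprM -[(2 * 2)%N]/4%N [_ * B ^+ 4]mulrC mextM in hd1.
rewrite exprVn -!exprM -[(2 * 2)%N]/4%N in hd2.
rewrite mextV // !mextX -/g in hd1 hd2.
have AN : mext A (-1) ^+ 2 = 1 by rewrite -mextX (mext_evenX_N1 A_lin 0).
rewrite hd1.
have nb := g0 _ LB4; have na := g0 _ LA2V; have nphi := g0 _ phi_lin.
have n4 := mext_neq0 A_lin four_neq0; have m4 := mext_neq0 B_lin four_neq0.
have nN : mext A (-1) != 0 by rewrite mext_neq0 // oppr_eq0 oner_eq0.
rewrite (divE _ _ _ (mulf_neq0 nb na) keyn) (divE _ _ _ (mulf_neq0 nb na) keyp).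
rewrite (divE _ _ _ na hd2).
(* Writing q as [g phi ^+ 2] leaves only Gauss sums for [field]. *)
have -> : g (A ^+ 4)^-1 = g phi ^+ 2 / g (A ^+ 4).
  by rewrite expr2 rphi; apply: divE (g0 _ LA4) r4.
have -> : (- 4 : F) = -1 * 4 by rewrite mulN1r.
have -> : 16 = 4 ^+ 2 :> F by rewrite -natrX.
(* As [mext A (-1)] is its own inverse, the sign from the argument -4 can be matched with the one in
   [hF]. *)
have -> : mext A (-1 * 4) = mext A 4 / mext A (-1).
  rewrite mext_mul //; apply: (mulIf nN).
  by rewrite divfK // mulrAC -expr2 AN mul1r.
rewrite mext_exp //.
by field; rewrite nb na nphi n4 m4 nN !g0.
Qed.
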